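(* Let $(\mathcal X,\mathcal F,\mu)$ be a probability space and let $p,q\in\mathcal P$. The following statements are equivalent: (i) $q\in\mathcal E(p)$; (ii) $q$ is connected to $p$ by an open exponential arc; (iii) $\mathcal E(p)=\mathcal E(q)$; (iv) $L^{\Phi_1}(p)=L^{\Phi_1}(q)$ (as sets); (v) $\log\frac{q}{p}\in L^{\Phi_1}(p)\cap L^{\Phi_1}(q)$; (vi) $\frac{q}{p}\in L^{1+\varepsilon}(p)$ and $\frac{p}{q}\in L^{1+\varepsilon}(q)$ for some $\varepsilon>0$.
   Context: $(\mathcal X,\mathcal F,\mu)$ is a probability space; measurable functions are identified when equal $\mu$-a.s. $\mathcal P$ is the set of probability densities with respect to $\mu$ (i.e. $\int_{\mathcal X} p\,d\mu=1$) that are positive $\mu$-a.s. For $p\in\mathcal P$, $\mathbb E_p(u)=\int_{\mathcal X}u\,p\,d\mu$, and $L^{a}(p)$ is the Lebesgue space with respect to the measure $p\,d\mu$. $L^0$ is the set of measurable functions $u:\mathcal X\to\mathbb R$. Orlicz space: $\Phi_1(x)=\cosh(x)-1$ and $L^{\Phi_1}(p)=\{u\in L^0:\exists\,\alpha>0 \text{ with } \mathbb E_p(\Phi_1(\alpha u))<+\infty\}$, a Banach space with the Luxembourg norm $\|u\|_{\Phi_1,p}=\inf\{k>0:\mathbb E_p(\Phi_1(u/k))\le 1\}$. Let $L^{\Phi_1}_0(p)=\{u\in L^{\Phi_1}(p):\mathbb E_p(u)=0\}$, with the induced norm. Open exponential arc: $p,q\in\mathcal P$ are connected by an open exponential arc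 if there is an open interval $I\supset[0,1]$ such that for every $\theta\in I$ the function $p^{1-\theta}q^{\theta}$ can be normalized to an element of $\mathcal P$, i.e. $\int_{\mathcal X}p^{1-\theta}q^{\theta}\,d\mu<+\infty$. Maximal exponential model: the cumulant generating functional is $K_p:L^{\Phi_1}_0(p)\to[0,+\infty]$, $K_p(u)=\log\mathbb E_p(e^u)$; $\operatorname{dom}K_p=\{u\in L^{\Phi_1}_0(p):K_p(u)<+\infty\}$, and $\mathring{\operatorname{dom}K_p}$ is its interior in $L^{\Phi_1}_0(p)$. The maximal exponential model at $p$ is $\mathcal E(p)=\{e^{u-K_p(u)}p: u\in\mathring{\operatorname{dom}K_p}\}\subseteq\mathcal P$. *)

(* Defs.v *)
From HB Require Import structures.
From mathcomp Require Import all_boot all_order all_algebra.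
From mathcomp Require Import all_classical all_reals all_analysis.

Set Implicit Arguments.
Unset Strict Implicit.
Unset Printing Implicit Defensive.

Import Order.TTheory GRing.Theory Num.Theory.
Import numFieldNormedType.Exports.

Local Open Scope classical_set_scope.
Local Open Scope ring_scope.

(* Elements of the function spaces are represented by actual measurable
   functions; every set of functions below is closed under mu-a.e. equality
   among measurable functions, so that equality of these sets is equality of
   the corresponding sets of classes. *)

Section ExponentialModel.
Context {d : measure_display} {T : measurableType d} {R : realType}.
Variable mu : probability T R.
Implicit Types (p q u v : T -> R).

Definition L0 : set (T -> R) := [set u | measurable_fun setT u].

Definition densities : set (T -> R) :=
  [set p | [/\ L0 p,
               (\int[mu]_x (p x)%:E = 1)%E &
               {ae mu, forall x, 0 < p x}]].

Definition Exp p u : \bar R := (\int[mu]_x (u x * p x)%:E)%E.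

Definition Lebesgue (a : R) p : set (T -> R) :=
  [set u | L0 u /\ (Exp p (fun x => `|u x| `^ a)%R < +oo)%E].

(* cosh x - 1 *)
Definition Phi1 (x : R) : R := (expR x + expR (- x)) / 2 - 1.

Definition LPhi1 p : set (T -> R) :=
  [set u | L0 u /\
    exists2 alpha : R, 0 < alpha &
      (Exp p (fun x => Phi1 (alpha * u x))%R < +oo)%E].

Definition luxemburg p u : R :=
  inf [set k : R | 0 < k /\ (Exp p (fun x => Phi1 (u x / k))%R <= 1)%E].

Definition LPhi1_0 p : set (T -> R) :=
  [set u | LPhi1 p u /\ Exp p u = 0%E].

Definition cumulant p u : \bar R := lne (Exp p (fun x => expR (u x))).

Definition domK p : set (T -> R) :=
  [set u | LPhi1_0 p u /\ (cumulant p u < +oo)%E].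

(* The interior is taken in [LPhi1_0 p], for the (semi)norm [luxemburg p]. *)
Definition int_domK p : set (T -> R) :=
  [set u | domK p u /\
    exists2 r : R, 0 < r &
      forall v, LPhi1_0 p v -> luxemburg p (v \- u) < r -> domK p v].

Definition max_exp_model p : set (T -> R) :=
  [set q | L0 q /\
    exists2 u, int_domK p u &
      {ae mu, forall x, q x = expR (u x - fine (cumulant p u)) * p x}].

Definition open_exp_arc p q : Prop :=
  exists I : set R,
    [/\ open I, is_interval I, `[0, 1] `<=` I &
        forall theta, I theta ->
          (\int[mu]_x (p x `^ (1 - theta) * q x `^ theta)%:E < +oo)%E].

End ExponentialModel.

(* Main.v *)
(* Put w = ln (q / p), so that q = e^w p.  Everything reduces to one condition
   on exponential moments: E_p (e^((1+e) w)) and E_p (e^(-e w)) are finite for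
   some e > 0 ([moment_arc]).  It passes from p to q because
   E_q (e^(a w)) = E_p (e^((1+a) w)).  Convex-combination bounds, in the crude form
   e^(s v + (1-s) w) <= e^v + e^w, replace Hoelder's inequality: they give
   L^Phi1 (p) = L^Phi1 (q) from the condition, and show that w - E_p w is interior
   to dom K_p.  Conversely, if u is interior then (1+c) u stays in dom K_p for
   some c > 0.  If the Orlicz spaces agree, they contain w because w^+ lies in
   L^Phi1 (p) and w^- in L^Phi1 (q).  Finally (iii) follows from (i) <-> (iv) for
   all pairs of densities, (iv) being an equivalence relation. *)
Require Import Defs.
From HB Require Import structures.
From mathcomp Require Import all_boot all_order all_algebra.
From mathcomp Require Import all_classical all_reals all_analysis.
From mathcomp Require Import measurable_realfun ring lra.

Set Implicit Arguments.
Unset Strict Implicit.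
Unset Printing Implicit Defensive.

Import Order.TTheory GRing.Theory Num.Theory.
Import numFieldNormedType.Exports.

Local Open Scope classical_set_scope.
Local Open Scope ring_scope.

(** * Convexity of the exponential and comparison of [Phi1] with [exp |x|] *)

Section RealFacts.
Context {R : realType}.
Implicit Types x t : R.

(** Convexity of exp on the segment from 0 to [x]. It follows from the tangent bound
    [1 + y <= exp y], moved to the point [t * x] and evaluated at both ends. *)
Lemma expR_scale x t : 0 <= t <= 1 -> expR (t * x) <= t * expR x + (1 - t).
Proof.
move=> /andP[t0 t1].
have e1 : expR (t * x) * (1 + (1 - t) * x) <= expR x.
  have -> : x = t * x + (1 - t) * x by ring.
  rewrite expRD.
  have -> : t * (t * x + (1 - t) * x) = t * x by ring.
  have -> : (1 - t) * (t * x + (1 - t) * x) = (1 - t) * x by ring.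
  by rewrite ler_pM2l ?expR_gt0// expR_ge1Dx.
have e0 : expR (t * x) * (1 + - (t * x)) <= 1.
  rewrite -[leRHS]expR0 -(subrr (t * x)) expRD.
  by rewrite ler_pM2l ?expR_gt0// expR_ge1Dx.
(* In the average with weights [t] and [1 - t] the linear terms of the two tangent bounds cancel. *)
have -> : expR (t * x) = t * (expR (t * x) * (1 + (1 - t) * x)) +
    (1 - t) * (expR (t * x) * (1 + - (t * x))) by ring.
apply: lerD; first exact: ler_wpM2l.
by rewrite -[leRHS]mulr1 ler_wpM2l// subr_ge0.
Qed.

Lemma Phi1_scale x t : 0 <= t <= 1 -> Phi1 (t * x) <= t * Phi1 x.
Proof.
move=> t01; have := expR_scale x t01; have := expR_scale (- x) t01.
by rewrite /Phi1 mulrN; lra.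
Qed.

(** Together with [Phi1_le_expR] this makes [Phi1] and [exp |x|] interchangeable for integrability
    under a finite measure. *)
Lemma expR_le_Phi1 x : expR `|x| <= 2 * (Phi1 x + 1).
Proof.
rewrite /Phi1; have := expR_ge0 x; have := expR_ge0 (- x).
by case: (ger0P x) => _; lra.
Qed.

Lemma Phi1_le_expR x : Phi1 x <= expR `|x|.
Proof.
rewrite /Phi1; have : expR x <= expR `|x| by rewrite ler_expR ler_norm.
have : expR (- x) <= expR `|x| by rewrite ler_expR -normrN ler_norm.
by have := expR_ge0 x; have := expR_ge0 (- x); lra.
Qed.

Lemma Phi1_ge0 x : 0 <= Phi1 x.
Proof.
by rewrite /Phi1; have := expR_ge1Dx x; have := expR_ge1Dx (- x); lra.
Qed.

Lemma measurable_Phi1 : measurable_fun setT (@Phi1 R).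
Proof.
rewrite /Phi1; apply: measurable_funB => //; apply: measurable_funM => //.
apply: measurable_funD; first exact: measurable_expR.
by apply: measurableT_comp; [exact: measurable_expR|exact: oppr_measurable].
Qed.

Lemma measurable_invr : measurable_fun setT (fun x : R => x^-1).
Proof.
(* Squaring makes the base nonnegative, so the inverse becomes a real power. At 0 both sides are
   0. *)
rewrite (_ : (fun _ => _) = (fun x => x * (x ^+ 2) `^ (-1))).
  apply: measurable_funM => //.
  apply: (measurableT_comp (measurable_powR (-1))); exact: exprn_measurable.
apply/funext => x; rewrite powR_inv1 ?sqr_ge0//.
have [->|x0] := eqVneq x 0; first by rewrite mul0r invr0.
by field.
Qed.

End RealFacts.

(** * Comparison of integrals under almost everywhere hypotheses *)

Section Integrals.
Context {d : measure_display} {T : measurableType d} {R : realType}.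
Variable mu : measure T R.
Implicit Types f g h : T -> R.

Lemma ae_integralE f g : measurable_fun setT f -> measurable_fun setT g ->
  {ae mu, forall x, f x = g x} ->
  (\int[mu]_x (f x)%:E = \int[mu]_x (g x)%:E)%E.
Proof.
move=> mf mg fg; apply: ae_eq_integral => //; try exact/measurable_EFinP.
by apply: filterS fg => x -> _.
Qed.

(** Densities are positive only almost everywhere. The absolute value supplies the pointwise
    nonnegativity that the integration lemmas require. *)
Lemma ae_integral_norm f : measurable_fun setT f ->
  {ae mu, forall x, 0 <= f x} ->
  (\int[mu]_x (f x)%:E = \int[mu]_x (`|f x|)%:E)%E.
Proof.
move=> mf f0; apply: ae_integralE => //; first exact: measurableT_comp.
by apply: filterS f0 => x fx0; rewrite ger0_norm.
Qed.

Lemma ae_integral_le f g : measurable_fun setT f -> measurable_fun setT g ->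
  {ae mu, forall x, 0 <= f x <= g x} ->
  (\int[mu]_x (f x)%:E <= \int[mu]_x (g x)%:E)%E.
Proof.
move=> mf mg fg.
rewrite ae_integral_norm//; last by apply: filterS fg => x /andP[].
rewrite [leRHS]ae_integral_norm//; last first.
  by apply: filterS fg => x /andP[/le_trans]; apply.
apply: ae_ge0_le_integral => //.
- by apply/measurable_EFinP; exact: measurableT_comp.
- by apply/measurable_EFinP; exact: measurableT_comp.
- apply: filterS fg => x /andP[f0 fg] _; rewrite lee_fin.
  by rewrite !ger0_norm// (le_trans f0).
Qed.

Lemma ae_integral_lty (c : R) f g h :
  measurable_fun setT f -> measurable_fun setT g -> measurable_fun setT h ->
  0 <= c ->
  {ae mu, forall x, [/\ 0 <= f x, 0 <= g x, 0 <= h x &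
                        f x <= c * (g x + h x)]} ->
  (\int[mu]_x (g x)%:E < +oo)%E -> (\int[mu]_x (h x)%:E < +oo)%E ->
  (\int[mu]_x (f x)%:E < +oo)%E.
Proof.
move=> mf mg mh c0 fgh.
have mng : measurable_fun setT (fun x => `|g x|) by exact: measurableT_comp.
have mnh : measurable_fun setT (fun x => `|h x|) by exact: measurableT_comp.
rewrite [in X in X -> _]ae_integral_norm//; last by apply: filterS fgh => x [].
rewrite [in X in _ -> X -> _]ae_integral_norm//; last by apply: filterS fgh => x [].
move=> goo hoo.
apply: (@le_lt_trans _ _ (\int[mu]_x (c * (`|g x| + `|h x|))%:E)%E).
  apply: ae_integral_le => //.
    by apply: measurable_funM => //; exact: measurable_funD.
  by apply: filterS fgh => x [f0 g0 h0 le]; rewrite f0 !ger0_norm.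
under eq_integral do rewrite EFinM EFinD.
rewrite ge0_integralZl_EFin//; last 2 first.
- by move=> x _; rewrite -EFinD lee_fin addr_ge0.
- by apply: emeasurable_funD; exact/measurable_EFinP.
rewrite ge0_integralD//; last 2 first.
- exact/measurable_EFinP.
- exact/measurable_EFinP.
by rewrite lte_mul_pinfty// lte_add_pinfty.
Qed.

End Integrals.

(** * Exponential moments and the Orlicz space described by them *)

Section ExponentialMoments.
Context {d : measure_display} {T : measurableType d} {R : realType}.
Variable mu : probability T R.
Implicit Types p q u v w : T -> R.

Definition exp_moment p u : Prop :=
  (\int[mu]_x (expR (u x) * p x)%:E < +oo)%E.

(** For densities the quotient is positive outside a null set; on that set [ln] and division only
    contribute default values. *)
Definition log_ratio p q : T -> R := fun x => ln (q x / p x).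

Lemma measurable_expRM p u : L0 p -> L0 u ->
  measurable_fun setT (fun x => expR (u x) * p x).
Proof.
move=> mp mu'; apply: measurable_funM => //.
exact: (measurableT_comp (@measurable_expR R)).
Qed.

(* Replaces Young's inequality: [exp (max v w) <= exp v + exp w]. *)
Lemma exp_moment_max (c : R) p u v w :
  densities mu p -> L0 u -> L0 v -> L0 w ->
  {ae mu, forall x, u x <= c + Num.max (v x) (w x)} ->
  exp_moment p v -> exp_moment p w -> exp_moment p u.
Proof.
move=> [mp _ p0] lu lv lw uvw.
apply: (@ae_integral_lty _ _ _ _ (expR c)); try exact: measurable_expRM.
  exact: expR_ge0.
apply: filterS2 p0 uvw => x px ux.
split; try by rewrite mulr_ge0 ?expR_ge0 ?ltW.
rewrite -mulrDl mulrA ler_pM2r//.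
apply: (@le_trans _ _ (expR (c + Num.max (v x) (w x)))); first by rewrite ler_expR.
rewrite expRD ler_pM2l ?expR_gt0// maxEle.
by case: ifP => _; rewrite ?lerDl ?lerDr expR_ge0.
Qed.

Lemma exp_moment_le p u v : densities mu p -> L0 u -> L0 v ->
  {ae mu, forall x, u x <= v x} -> exp_moment p v -> exp_moment p u.
Proof.
move=> dp lu lv uv ev; apply: (@exp_moment_max 0 _ _ v v) => //.
by apply: filterS uv => x; rewrite add0r maxxx.
Qed.

Lemma exp_moment0 p : densities mu p -> exp_moment p (cst 0).
Proof.
move=> [_ p1 _]; rewrite /exp_moment.
by under eq_integral do rewrite /= expR0 mul1r; rewrite p1 ltry.
Qed.

Lemma measurable_log_ratio p q : L0 p -> L0 q -> L0 (log_ratio p q).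
Proof.
move=> mp mq; apply: (measurableT_comp (@measurable_ln R)).
apply: measurable_funM => //.
exact: (measurableT_comp (@measurable_invr R)).
Qed.

Lemma log_ratioE p q : densities mu p -> densities mu q ->
  {ae mu, forall x, q x = expR (log_ratio p q x) * p x}.
Proof.
move=> [_ _ p0] [_ _ q0]; apply: filterS2 p0 q0 => x px qx.
by rewrite /log_ratio lnK ?posrE ?divr_gt0// divfK// gt_eqF.
Qed.

Lemma log_ratioC p q : densities mu p -> densities mu q ->
  {ae mu, forall x, log_ratio q p x = - log_ratio p q x}.
Proof.
move=> [_ _ p0] [_ _ q0]; apply: filterS2 p0 q0 => x px qx.
by rewrite /log_ratio -lnV ?posrE ?divr_gt0// invf_div.
Qed.

(** Since [q = e^w p] almost everywhere, with [w] the log ratio, passing from [q] to [p] adds [w] to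
    the exponent. *)
Lemma exp_moment_change p q u v : densities mu p -> densities mu q ->
  L0 u -> L0 v -> {ae mu, forall x, v x = u x + log_ratio p q x} ->
  exp_moment q u <-> exp_moment p v.
Proof.
move=> dp dq lu lv uv; rewrite /exp_moment.
rewrite (@ae_integralE _ _ _ _ (fun x => expR (u x) * q x)
  (fun x => expR (v x) * p x))//; try by [case: dp => *; exact: measurable_expRM|
    case: dq => *; exact: measurable_expRM].
by apply: filterS2 uv (log_ratioE dp dq) => x -> ->; rewrite mulrA -expRD.
Qed.

Lemma measurable_Phi1M p u (a : R) : L0 p -> L0 u ->
  measurable_fun setT (fun x => Phi1 (a * u x) * p x).
Proof.
move=> mp mu'; apply: measurable_funM => //.
by apply: (measurableT_comp (@measurable_Phi1 R)); exact: measurable_funM.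
Qed.

(** [Phi1] and [exp |x|] bound each other up to a factor and an additive constant. The constant,
    weighted by [p], has a finite integral because [p] integrates to 1. *)
Lemma LPhi1P p u : densities mu p ->
  LPhi1 mu p u <-> L0 u /\ exists2 a : R, 0 < a & exp_moment p (fun x => a * `|u x|).
Proof.
move=> dp; have [mp p1 p0] := dp.
have la a : L0 u -> L0 (fun x => a * `|u x|).
  by move=> lu; apply: measurable_funM => //; exact: measurableT_comp.
split=> -[lu [a a0 H]]; split=> //; exists a => //; move: H; rewrite /exp_moment /Exp.
- move=> H; apply: (@ae_integral_lty _ _ _ _ 2 _ _ p) H _ => //.
  + by apply: measurable_expRM => //; exact: la.
  + exact: measurable_Phi1M.
  + apply: filterS p0 => x px; split; try by rewrite ?mulr_ge0 ?expR_ge0 ?Phi1_ge0 ?ltW.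
    rewrite -[X in _ + X]mul1r -mulrDl mulrA ler_pM2r//.
    by rewrite -{1}(gtr0_norm a0) -normrM expR_le_Phi1.
  + by rewrite p1 ltry.
- move=> H; apply: (@ae_integral_lty _ _ _ _ 1 _ _ p) H _ => //.
  + exact: measurable_Phi1M.
  + by apply: measurable_expRM => //; exact: la.
  + apply: filterS p0 => x px; split; try by rewrite ?mulr_ge0 ?expR_ge0 ?Phi1_ge0 ?ltW.
    rewrite mul1r -[X in _ + X]mul1r -mulrDl ler_pM2r//.
    rewrite -{2}(gtr0_norm a0) -normrM (le_trans (Phi1_le_expR _))//.
    by rewrite lerDl.
  + by rewrite p1 ltry.
Qed.

(** The smaller of the two exponents admissible for [v] and [w] serves for [u]. Sums and the
    positive and negative parts of the log ratio are handled through this domination. *)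
Lemma LPhi1_max p u v w : densities mu p -> L0 u ->
  {ae mu, forall x, `|u x| <= Num.max `|v x| `|w x|} ->
  LPhi1 mu p v -> LPhi1 mu p w -> LPhi1 mu p u.
Proof.
move=> dp lu uvw /(LPhi1P _ dp)[lv [a a0 ev]] /(LPhi1P _ dp)[lw [b b0 ew]].
apply/LPhi1P => //; split=> //; exists (Num.min a b); first by rewrite lt_min a0.
apply: (@exp_moment_max 0 p _ (fun x => a * `|v x|) (fun x => b * `|w x|)) => //.
- by apply: measurable_funM => //; exact: measurableT_comp.
- by apply: measurable_funM => //; exact: measurableT_comp.
- by apply: measurable_funM => //; exact: measurableT_comp.
apply: filterS uvw => x uvw; rewrite add0r le_max; apply/orP.
move: uvw; rewrite le_max => /orP[h|h]; [left|right];
  by apply: ler_pM => //; rewrite ?ge_min ?lexx ?orbT// le_min !ltW.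
Qed.

Lemma LPhi1Z p u (k : R) : densities mu p -> LPhi1 mu p u ->
  LPhi1 mu p (fun x => k * u x).
Proof.
move=> dp /(LPhi1P _ dp)[lu [a a0 ea]]; apply/LPhi1P => //.
split; first exact: measurable_funM.
(* The summand 1 keeps the denominator positive when [k = 0]. *)
exists (a / (1 + `|k|)); first by rewrite divr_gt0// ltr_pwDl.
apply: exp_moment_le ea => //.
- by apply: measurable_funM => //; apply: measurableT_comp => //; exact: measurable_funM.
- by apply: measurable_funM => //; exact: measurableT_comp.
apply: aeW => x; rewrite normrM mulrA ler_wpM2r// mulrAC ler_pdivrMr ?ltr_pwDl//.
by rewrite ler_pM2l// lerDr.
Qed.

Lemma LPhi1D p u v : densities mu p -> LPhi1 mu p u -> LPhi1 mu p v ->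
  LPhi1 mu p (fun x => u x + v x).
Proof.
move=> dp pu pv; have lu := pu.1; have lv := pv.1.
apply: LPhi1_max (LPhi1Z 2 dp pu) (LPhi1Z 2 dp pv) => //.
  exact: measurable_funD.
apply: aeW => x; rewrite !normrM gtr0_norm//.
have := ler_normD (u x) (v x); rewrite le_max => h; apply/orP.
by case: (leP `|u x| `|v x|) => ?; [right|left]; lra.
Qed.

Lemma LPhi1_cst p (c : R) : densities mu p -> LPhi1 mu p (cst c).
Proof.
move=> dp; have [mp p1 _] := dp.
apply/LPhi1P => //; split; first exact: measurable_cst.
exists 1 => //; apply: (@exp_moment_max `|c| _ _ (cst 0) (cst 0)) (exp_moment0 dp) => //.
- exact: (@measurable_cst _ _ _ _ setT (1 * `|c|)).
- exact: measurable_cst.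
- exact: measurable_cst.
- by apply: aeW => x /=; rewrite mul1r maxxx addr0.
- exact: exp_moment0.
Qed.

(** Domination by the exponential moment: [a |u| <= exp (a |u|)]. *)
Lemma LPhi1_integrable p u : densities mu p -> LPhi1 mu p u ->
  mu.-integrable setT (EFin \o (fun x => u x * p x)).
Proof.
move=> dp /(LPhi1P _ dp)[lu [a a0 ea]]; have [mp p1 p0] := dp.
have mup : measurable_fun setT (fun x => u x * p x) by exact: measurable_funM.
have mau : L0 (fun x => a * `|u x|).
  by apply: measurable_funM => //; exact: measurableT_comp.
apply/integrableP; split; first exact/measurable_EFinP.
apply: (@ae_integral_lty _ _ _ mu a^-1 (fun x => `|u x * p x|) _ p) ea _ => //.
- exact: measurableT_comp.
- exact: measurable_expRM.
- by rewrite invr_ge0 ltW.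
- apply: filterS p0 => x px; split; rewrite ?normr_ge0 ?mulr_ge0 ?expR_ge0 ?(ltW px)//.
  rewrite normrM (gtr0_norm px) -[X in _ + X]mul1r -mulrDl mulrA ler_pM2r//.
  rewrite mulrC ler_pdivlMr// mulrC (le_trans _ (_ : expR (a * `|u x|) <= _))//.
    by have := expR_ge1Dx (a * `|u x|); lra.
  by rewrite lerDl.
- by rewrite p1 ltry.
Qed.

Lemma LPhi1_Exp_fin p u : densities mu p -> LPhi1 mu p u ->
  Exp mu p u \is a fin_num.
Proof. by move=> dp /(LPhi1_integrable dp)/integrable_fin_num; exact. Qed.

Lemma LPhi1_0_cent p u : densities mu p -> LPhi1 mu p u ->
  LPhi1_0 mu p (fun x => u x - fine (Exp mu p u)).
Proof.
move=> dp pu; have [mp p1 p0] := dp; split.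
  by apply: LPhi1D => //; exact: LPhi1_cst.
rewrite /Exp; under eq_integral do rewrite mulrBl EFinB.
rewrite integralB_EFin//; [|exact: LPhi1_integrable|]; last first.
  by apply: (@LPhi1_integrable p (cst _)) => //; exact: LPhi1_cst.
under [X in (_ - X)%E]eq_integral do rewrite EFinM.
rewrite integralZl//; last first.
  have := LPhi1_integrable dp (LPhi1_cst 1 dp).
  by under eq_fun do rewrite /= mul1r.
by rewrite p1 mule1 fineK ?subee// LPhi1_Exp_fin.
Qed.

Lemma LPhi1_0Z p u (k : R) : densities mu p -> LPhi1_0 mu p u ->
  LPhi1_0 mu p (fun x => k * u x).
Proof.
move=> dp [pu u0]; split; first exact: LPhi1Z.
rewrite /Exp; under eq_integral do rewrite -mulrA EFinM.
rewrite integralZl//; last exact: LPhi1_integrable.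
by rewrite -[X in (_ * X)%E]/(Exp mu p u) u0 mule0.
Qed.

End ExponentialMoments.

(** * Open arcs, powers of the density ratio and equality of Orlicz spaces *)

Section Arcs.
Context {d : measure_display} {T : measurableType d} {R : realType}.
Variable mu : probability T R.
Implicit Types p q u v w : T -> R.

(** As [p^(1-t) q^t = e^(t w) p], this is the arc condition at the two parameters [1 + e] and [- e],
    just beyond both ends of [[0, 1]]. *)
Definition moment_arc p q : Prop :=
  exists2 e : R, 0 < e &
    exp_moment mu p (fun x => (1 + e) * log_ratio p q x) /\
    exp_moment mu p (fun x => - e * log_ratio p q x).

(** Pointwise [t u] is at most [b u] where [u >= 0] and at most [a u] elsewhere, so no interpolation
    inequality is called for. *)
Lemma exp_moment_between p u (a b t : R) : densities mu p -> L0 u ->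
  a <= t <= b -> exp_moment mu p (fun x => a * u x) ->
  exp_moment mu p (fun x => b * u x) -> exp_moment mu p (fun x => t * u x).
Proof.
move=> dp lu /andP[at_ tb]; apply: (@exp_moment_max _ _ _ _ 0) => //;
  try exact: measurable_funM.
apply: aeW => x; rewrite add0r le_max; apply/orP.
by have [u0|/ltW u0] := leP 0 (u x); [right; rewrite ler_wpM2r|left; rewrite ler_wnM2r].
Qed.

Lemma density_log_ratio p q : densities mu p -> densities mu q ->
  L0 (log_ratio p q).
Proof. by move=> [? _ _] [? _ _]; exact: measurable_log_ratio. Qed.

(** The reversed ratio has logarithm [- w], and the change of density adds [w]:
    [- a w + w = (1 - a) w]. The reflection [a -> 1 - a] exchanges [1 + e] and [- e]. *)
Lemma exp_moment_swap p q (a : R) : densities mu p -> densities mu q ->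
  exp_moment mu q (fun x => a * log_ratio q p x) <->
  exp_moment mu p (fun x => (1 - a) * log_ratio p q x).
Proof.
move=> dp dq; have lpq := density_log_ratio dp dq.
have lqp := density_log_ratio dq dp.
apply: exp_moment_change => //; try exact: measurable_funM.
by apply: filterS (log_ratioC dp dq) => x ->; ring.
Qed.

Lemma moment_arc_sym p q : densities mu p -> densities mu q ->
  moment_arc p q -> moment_arc q p.
Proof.
move=> dp dq [e e0 [h1 h2]]; exists e => //; split; apply/exp_moment_swap => //.
  by rewrite (_ : 1 - (1 + e) = - e)//; ring.
by rewrite opprK.
Qed.

Lemma moment_arc_open p q : densities mu p -> densities mu q ->
  open_exp_arc mu p q <-> moment_arc p q.
Proof.
move=> dp dq; have lpq := density_log_ratio dp dq.
have [mp _ p0] := dp; have [mq _ q0] := dq.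
have E (t : R) : (\int[mu]_x (p x `^ (1 - t) * q x `^ t)%:E < +oo)%E <->
    exp_moment mu p (fun x => t * log_ratio p q x).
  rewrite /exp_moment (@ae_integralE _ _ _ _ (fun x => p x `^ (1 - t) * q x `^ t)
    (fun x => expR (t * log_ratio p q x) * p x))//.
  - apply: measurable_funM.
      exact: (measurableT_comp (measurable_powR _)).
    exact: (measurableT_comp (measurable_powR _)).
  - by apply: measurable_expRM => //; exact: measurable_funM.
  apply: filterS2 p0 q0 => x px qx.
  rewrite /powR !gt_eqF// -{2}(lnK px) -!expRD /log_ratio ln_div ?posrE//.
  by congr expR; ring.
split=> [[I [oI iI I01 HI]]|[e e0 [h1 h2]]].
  (* Openness is used only at 0 and 1, to step past each end. Half the radius is taken because balls
     are strict. *)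
  have nbr (z : R) : I z -> exists2 e, 0 < e & I (z + e) /\ I (z - e).
    move=> Iz; have /nbhs_ballP[e /= e0 he] := open_nbhs_nbhs (conj oI Iz).
    exists (e / 2); first by rewrite divr_gt0.
    have eab : `|e / 2| < e by rewrite gtr0_norm; lra.
    by split; apply: he; rewrite /ball /= ?opprD ?opprK addrA subrr add0r ?normrN.
  have I0 : I 0 by apply: I01; rewrite /= in_itv /= lexx ler01.
  have I1 : I 1 by apply: I01; rewrite /= in_itv /= lexx ler01.
  have [e e0 [_ Ie]] := nbr _ I0; have [f f0 [If _]] := nbr _ I1.
  (* One margin must serve both ends; convexity of the interval [I] permits shrinking to the smaller
     one. *)
  have gle : 0 < Num.min e f by rewrite lt_min e0.
  exists (Num.min e f) => //; split; apply/E/HI.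
    by apply: (iI _ _ I1 If); rewrite lerD2l ge_min lexx orbT lerDl ltW.
  apply: (iI _ _ Ie I0).
  by rewrite sub0r lerN2 ge_min lexx oppr_le0 (ltW gle).
exists [set` `]- e, 1 + e[]; split.
- exact: interval_open.
- exact: interval_is_interval.
- by apply: subset_itv; rewrite bnd_simp; lra.
- move=> t /=; rewrite in_itv /= => /andP[/ltW et /ltW te].
  by apply: (E t).2; apply: exp_moment_between h2 h1; rewrite ?et.
Qed.

(** The power [1 + e] of [q / p] under [p] is the moment at [1 + e]; that of [p / q] under [q]
    reflects to the moment at [- e]. *)
Lemma moment_arc_Lebesgue p q : densities mu p -> densities mu q ->
  moment_arc p q <->
  exists2 e : R, 0 < e & Lebesgue mu (1 + e) p (fun x => q x / p x) /\
                         Lebesgue mu (1 + e) q (fun x => p x / q x).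
Proof.
move=> dp dq.
have E (a b : T -> R) (t : R) : densities mu a -> densities mu b ->
    Lebesgue mu t a (fun x => b x / a x) <->
    exp_moment mu a (fun x => t * log_ratio a b x).
  move=> da db; have [ma _ a0] := da; have [mb _ b0] := db.
  have mba : L0 (fun x => b x / a x).
    apply: measurable_funM => //.
    exact: (measurableT_comp (@measurable_invr R)).
  rewrite /Lebesgue /Exp /exp_moment /=.
  rewrite (@ae_integralE _ _ _ _ (fun x => `|b x / a x| `^ t * a x)
    (fun x => expR (t * log_ratio a b x) * a x))//; first by split=> [[]|].
  - apply: measurable_funM => //; apply: (measurableT_comp (measurable_powR _)).
    exact: measurableT_comp.
  - apply: measurable_expRM => //; apply: measurable_funM => //.
    exact: density_log_ratio.
  apply: filterS2 a0 b0 => x ax bx.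
  by rewrite gtr0_norm ?divr_gt0// /powR gt_eqF// divr_gt0.
split=> -[e e0 [h1 h2]]; exists e => //.
  split; apply/E => //; apply/exp_moment_swap => //.
  by rewrite (_ : 1 - (1 + e) = - e)//; ring.
move/E: h1 => h1; split; first exact: h1.
have := (exp_moment_swap (1 + e) dp dq).1 ((E _ _ _ dq dp).1 h2).
by rewrite (_ : 1 - (1 + e) = - e)//; ring.
Qed.

(** Membership under [p] controls the moment at [- e]. Membership under [q] controls [e w] there,
    which is [(1 + e) w] under [p]. *)
Lemma moment_arc_LPhi1_log_ratio p q : densities mu p -> densities mu q ->
  LPhi1 mu p (log_ratio p q) -> LPhi1 mu q (log_ratio p q) -> moment_arc p q.
Proof.
move=> dp dq /(LPhi1P _ dp)[lw [a a0 ha]] /(LPhi1P _ dq)[_ [b b0 hb]].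
have lM r (c : R) : L0 (log_ratio p q) -> L0 r -> L0 (fun x => c * log_ratio p q x + r x).
  by move=> ? ?; apply: measurable_funD => //; exact: measurable_funM.
have lN (c : R) : L0 (fun x => c * `|log_ratio p q x|).
  by apply: measurable_funM => //; exact: measurableT_comp.
pose e := Num.min a b.
have e0 : 0 < e by rewrite lt_min a0.
exists e => //; split; last first.
  apply: exp_moment_le ha => //; first exact: measurable_funM.
  apply: aeW => x; apply: (@le_trans _ _ (e * `|log_ratio p q x|)).
    by rewrite mulNr -mulrN ler_wpM2l ?(ltW e0)// -normrN ler_norm.
  by rewrite ler_wpM2r// ge_min lexx.
apply/(@exp_moment_change _ _ _ _ p q (fun x => e * log_ratio p q x)) => //.
- exact: measurable_funM.
- exact: measurable_funM.
- by apply: aeW => x; ring.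
apply: exp_moment_le hb => //; first exact: measurable_funM.
apply: aeW => x; apply: (@le_trans _ _ (e * `|log_ratio p q x|)).
  by rewrite ler_wpM2l ?(ltW e0)// ler_norm.
by rewrite ler_wpM2r// ge_min lexx orbT.
Qed.

(** Under [p] the exponent gains a summand [w]. Writing it as [(1 + e) w] with weight [1 / (1 + e)]
    leaves the weight [e / (1 + e)] for [a |u|], whence the new exponent. *)
Lemma moment_arc_LPhi1_sub p q : densities mu p -> densities mu q ->
  moment_arc p q -> LPhi1 mu p `<=` LPhi1 mu q.
Proof.
move=> dp dq [e e0 [h _]] u /(LPhi1P _ dp)[lu [a a0 ha]].
have lpq := density_log_ratio dp dq.
have mau (c : R) : L0 (fun x => c * `|u x|).
  by apply: measurable_funM => //; exact: measurableT_comp.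
apply/LPhi1P => //; split=> //; exists (a * (e / (1 + e))).
  by rewrite mulr_gt0// divr_gt0//; lra.
apply/(@exp_moment_change _ _ _ _ p q _
  (fun x => a * (e / (1 + e)) * `|u x| + log_ratio p q x)) => //.
- by apply: measurable_funD => //; exact: mau.
- exact: aeW.
apply: (@exp_moment_max _ _ _ _ 0) ha h => //.
- by apply: measurable_funD => //; exact: mau.
- exact: measurable_funM.
apply: aeW => x; rewrite add0r [leLHS](_ : _ = e / (1 + e) * (a * `|u x|) +
  (1 + e)^-1 * ((1 + e) * log_ratio p q x)); last by field; lra.
 set m := Num.max _ _.
have -> : m = e / (1 + e) * m + (1 + e)^-1 * m by field; lra.
by apply: lerD; apply: ler_wpM2l; rewrite ?divr_ge0 ?invr_ge0 ?le_max ?lexx ?orbT//; lra.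
Qed.

Lemma moment_arc_LPhi1_eq p q : densities mu p -> densities mu q ->
  moment_arc p q -> LPhi1 mu p = LPhi1 mu q.
Proof.
move=> dp dq arc; apply/seteqP; split; first exact: moment_arc_LPhi1_sub.
by apply: moment_arc_LPhi1_sub => //; exact: moment_arc_sym.
Qed.

Lemma LPhi1_eq_log_ratio p q : densities mu p -> densities mu q ->
  LPhi1 mu p = LPhi1 mu q -> LPhi1 mu p (log_ratio p q).
Proof.
move=> dp dq pq.
(* [exp w^+ <= 1 + b / a] is integrable against [a]. *)
have key a b : densities mu a -> densities mu b ->
    LPhi1 mu a (fun x => Num.max 0 (log_ratio a b x)).
  move=> da db; have lab := density_log_ratio da db.
  have [ma _ _] := da; have [mb b1 _] := db.
  have lm : L0 (fun x => Num.max 0 (log_ratio a b x)).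
    by apply: measurable_maxr => //; exact: measurable_cst.
  apply/LPhi1P => //; split=> //; exists 1 => //.
  apply: (@exp_moment_max _ _ _ _ 0 a _ (cst 0) (log_ratio a b)) => //.
  - by apply: measurable_funM => //; exact: measurableT_comp.
  - exact: measurable_cst.
  - by apply: aeW => x; rewrite mul1r add0r ger0_norm// le_max lexx.
  - exact: exp_moment0.
  rewrite /exp_moment (@ae_integralE _ _ _ _ _ b) ?b1 ?ltry//.
    exact: measurable_expRM.
  by apply: filterS (log_ratioE da db) => x ->.
(* With the densities exchanged, [key] places the negative part of the log ratio in the space of
   [q], which the hypothesis identifies with that of [p]. *)
have kq := key _ _ dq dp; rewrite -pq in kq.
apply: (LPhi1_max dp _ _ (key _ _ dp dq) kq); first exact: density_log_ratio.
apply: filterS (log_ratioC dp dq) => x ->.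
have nmax (y : R) : `|Num.max 0 y| = Num.max 0 y.
  by rewrite ger0_norm// le_max lexx.
rewrite !nmax !le_max.
by case: (ger0P (log_ratio p q x)) => h; rewrite lexx ?orbT.
Qed.

End Arcs.

(** * Luxemburg balls, the interior of the cumulant domain and the maximal model *)

Section MaximalExponentialModel.
Context {d : measure_display} {T : measurableType d} {R : realType}.
Variable mu : probability T R.
Implicit Types p q u v w : T -> R.

(** Without an admissible [k] the infimum in [luxemburg] would be a default value and carry no
    information on [u]. *)
Lemma luxemburg_nonempty p u : densities mu p -> LPhi1 mu p u ->
  exists2 k : R, 0 < k & (Exp mu p (fun x => Phi1 (u x / k)) <= 1)%E.
Proof.
move=> dp [lu [a a0 ha]]; have [mp p1 p0] := dp.
have M0 : (0 <= Exp mu p (fun x => Phi1 (a * u x)))%E.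
  rewrite /Exp ae_integral_norm ?integral_ge0//; first exact: measurable_Phi1M.
  by apply: filterS p0 => x px; rewrite mulr_ge0 ?Phi1_ge0 ?ltW.
have [M hM] : exists M : R, Exp mu p (fun x => Phi1 (a * u x)) = M%:E.
  by exists (fine (Exp mu p (fun x => Phi1 (a * u x)))); rewrite fineK// ge0_fin_numE.
rewrite hM lee_fin in M0.
(* This choice gives both [t <= 1], so that convexity applies, and [t * M <= 1]. *)
pose t := (1 + M)^-1; have M1 : 0 < 1 + M by lra.
have t01 : 0 <= t <= 1 by rewrite invr_ge0 ltW//= invf_le1//; lra.
exists (t * a)^-1; first by rewrite invr_gt0 mulr_gt0// invr_gt0.
rewrite (_ : (fun _ => _) = (fun x => Phi1 (t * a * u x))); last first.
  by apply/funext => x; rewrite invrK mulrC.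
apply: (@le_trans _ _ (\int[mu]_x (t * (Phi1 (a * u x) * p x))%:E)%E).
  apply: ae_integral_le; first exact: measurable_Phi1M.
    by apply: measurable_funM => //; exact: measurable_Phi1M.
  apply: filterS p0 => x px; rewrite mulr_ge0 ?Phi1_ge0 ?(ltW px)//=.
  by rewrite mulrA ler_pM2r// -mulrA Phi1_scale.
under eq_integral do rewrite EFinM.
rewrite integralZl//; last first.
  apply/integrableP; split; first by apply/measurable_EFinP; exact: measurable_Phi1M.
  rewrite -(ae_integral_norm (measurable_Phi1M a mp lu)) ?hM//.
  by apply: filterS p0 => x px; rewrite mulr_ge0 ?Phi1_ge0 ?ltW.
rewrite -[X in (_ * X)%E]/(Exp mu p (fun x => Phi1 (a * u x))) hM -EFinM lee_fin.
by rewrite mulrC ler_pdivrMr//; lra.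
Qed.

(** Some admissible [k] lies below [r], and [|u| / r <= |u| / k]. *)
Lemma luxemburg_lt p u (r : R) : densities mu p -> LPhi1 mu p u ->
  0 < r -> luxemburg mu p u < r -> exp_moment mu p (fun x => r^-1 * `|u x|).
Proof.
move=> dp pu r0 /inf_lt[|k [k0 hk] kr].
  by have [k k0 hk] := luxemburg_nonempty dp pu; exists k.
have [mp p1 p0] := dp; have lu := pu.1.
have mM (c : R) : L0 (fun x => c * `|u x|).
  by apply: measurable_funM => //; exact: measurableT_comp.
apply: (@exp_moment_le _ _ _ _ _ _ (fun x => k^-1 * `|u x|)) => //.
  by apply: aeW => x; rewrite ler_wpM2r// lef_pV2// ltW.
have hk' : (Exp mu p (fun x => Phi1 (k^-1 * u x)) < +oo)%E.
  apply: le_lt_trans (ltry 1); rewrite (_ : (fun _ => _) = (fun x => Phi1 (u x / k)))//.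
  by apply/funext => x; rewrite mulrC.
apply: (@ae_integral_lty _ _ _ _ 2 _ _ p) hk' _ => //.
- exact: measurable_expRM.
- exact: measurable_Phi1M.
- apply: filterS p0 => x px; split; try by rewrite ?mulr_ge0 ?expR_ge0 ?Phi1_ge0 ?ltW.
  rewrite -[X in _ + X]mul1r -mulrDl mulrA ler_pM2r//.
  by rewrite -[X in X * `|_|]gtr0_norm ?invr_gt0// -normrM expR_le_Phi1.
- by rewrite p1 ltry.
Qed.

Lemma luxemburg_scale p u (r : R) : densities mu p -> LPhi1 mu p u -> 0 < r ->
  exists2 c : R, 0 < c & luxemburg mu p (fun x => c * u x) < r.
Proof.
move=> dp pu r0; have [k k0 hk] := luxemburg_nonempty dp pu.
(* With this [c], dividing [c u] by [r / 2] gives [u / k], so [r / 2] is admissible and the norm is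
   strictly below [r]. *)
exists (r / 2 / k); first by rewrite !divr_gt0.
apply: (@le_lt_trans _ _ (r / 2)); last by lra.
apply: ge_inf; first by exists 0 => x [/ltW].
split; first by rewrite divr_gt0.
rewrite (_ : (fun _ => _) = (fun x => Phi1 (u x / k)))//.
by apply/funext => x; congr Phi1; field; lra.
Qed.

Lemma cumulant_lty p u :
  (cumulant mu p u < +oo)%E <-> exp_moment mu p u.
Proof.
rewrite /cumulant /exp_moment -/(Exp mu p (fun x => expR (u x))).
by case: (Exp mu p _) => [s||] //=; split=> // _; rewrite ?ltry//; case: ifP; rewrite ?ltry.
Qed.

Lemma moment_arc_of_max_exp_model p q : densities mu p -> densities mu q ->
  max_exp_model mu p q -> moment_arc mu p q.
Proof.
move=> dp dq [lq [u [[pu0 _] [r r0 ball_u]] qE]].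
have pu := pu0.1; have lu := pu.1.
have /(LPhi1P _ dp)[_ [a a0 ha]] := pu.
move: (fine _) qE => K qE.
have wE : {ae mu, forall x, log_ratio p q x = u x - K}.
  have [_ _ p0] := dp; apply: filterS2 p0 qE => x px qx.
  by rewrite /log_ratio qx mulfK ?gt_eqF// expRK.
have [c c0 hc] := luxemburg_scale dp pu r0.
(* This point differs from [u] by [c u], small by the choice of [c], so interiority yields a moment
   of order larger than 1. *)
have /ball_u : LPhi1_0 mu p (fun x => (1 + c) * u x) by exact: LPhi1_0Z.
rewrite (_ : _ \- u = (fun x => c * u x)); last by apply/funext => x /=; ring.
move=> /(_ hc)[_ /cumulant_lty hcu].
have lw := density_log_ratio dp dq.
have e0 : 0 < Num.min a c by rewrite lt_min a0.
exists (Num.min a c) => //; split.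
  (* Up to the constant from [w = u - K], the exponent is at most [(1 + c) u] where [u >= 0] and at
     most 0 elsewhere. *)
  apply: (@exp_moment_max _ _ _ _ (- (1 + Num.min a c) * K) _ _ (cst 0)) (exp_moment0 dp) hcu => //.
  - exact: measurable_funM.
  - exact: measurable_cst.
  - exact: measurable_funM.
  apply: filterS wE => x ->.
  rewrite mulrBr addrC mulNr lerD2l le_max; apply/orP.
  have [ux|/ltW ux] := leP 0 (u x).
    by right; rewrite ler_wpM2r// lerD2l ge_min lexx orbT.
  by left; rewrite pmulr_rle0//; lra.
apply: (@exp_moment_max _ _ _ _ (Num.min a c * K)) (ha) (ha) => //.
- exact: measurable_funM.
- by apply: measurable_funM => //; exact: measurableT_comp.
- by apply: measurable_funM => //; exact: measurableT_comp.
apply: filterS wE => x ->; rewrite maxxx mulrBr addrC !mulNr opprK lerD2l.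
apply: (@le_trans _ _ (Num.min a c * `|u x|)).
  by rewrite -mulrN ler_wpM2l ?(ltW e0)// -normrN ler_norm.
by rewrite ler_wpM2r// ge_min lexx.
Qed.

Lemma max_exp_model_of_moment_arc p q : densities mu p -> densities mu q ->
  moment_arc mu p q -> LPhi1 mu p (log_ratio p q) -> max_exp_model mu p q.
Proof.
move=> dp dq [e e0 [h1 _]] pw; have lw := pw.1.
have [mp p1 p0] := dp; have [mq q1 q0] := dq.
(* Centering [w] by its mean makes it an element of [LPhi1_0]; as [q] integrates to 1, the cumulant
   of the centered function is [- c]. *)
set c := fine (Exp mu p (log_ratio p q)).
pose u x := log_ratio p q x - c.
have u_0 : LPhi1_0 mu p u by exact: LPhi1_0_cent.
have lu := u_0.1.1.
have Eu : Exp mu p (fun x => expR (u x)) = (expR (- c))%:E.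
  rewrite /Exp (@ae_integralE _ _ _ _ _ (fun x => expR (- c) * q x)).
  - under eq_integral do rewrite EFinM.
    rewrite integralZl ?q1 ?mule1//.
    have := LPhi1_integrable dq (LPhi1_cst 1 dq).
    by under eq_fun do rewrite /= mul1r.
  - exact: measurable_expRM.
  - exact: measurable_funM.
  apply: filterS (log_ratioE dp dq) => x ->.
  by rewrite mulrA -expRD addrC.
have Ku : cumulant mu p u = (- c)%:E.
  by rewrite /cumulant Eu lne_EFin ?expR_gt0// expRK.
split => //; exists u; last first.
  by apply: filterS (log_ratioE dp dq) => x ->; rewrite Ku /= /u opprK subrK.
split; first by split=> //; rewrite Ku ltry.
(* Write [v = (v - u) + w - c]. The moment at [1 + e] absorbs [w] with weight [1 / (1 + e)]; the
   remaining weight is the radius, whose inverse is the exponent obtained for [|v - u|]. *)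
exists (e / (1 + e)); first by rewrite divr_gt0//; lra.
move=> v v_0 vu; split=> //; apply/cumulant_lty.
have pv := v_0.1; have lv := pv.1.
have puv : LPhi1 mu p (v \- u).
  have := LPhi1D dp pv (LPhi1Z (- 1) dp u_0.1).
  by under eq_fun do rewrite mulN1r.
have hvu : exp_moment mu p (fun x => (e / (1 + e))^-1 * `|(v \- u) x|).
  by apply: luxemburg_lt => //; rewrite divr_gt0//; lra.
apply: (@exp_moment_max _ _ _ _ (- c)) hvu h1 => //.
- apply: measurable_funM => //; apply: measurableT_comp => //.
  exact: measurable_funB.
- exact: measurable_funM.
apply: aeW => x; set m := Num.max _ _.
have le1 : v x - u x <= e / (1 + e) * m.
  apply: le_trans (ler_norm _) _; rewrite -ler_pdivrMl ?divr_gt0//; last by lra.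
  by rewrite le_max lexx.
have le2 : log_ratio p q x <= (1 + e)^-1 * m.
  by rewrite -ler_pdivrMl ?invr_gt0 ?invrK ?le_max ?lexx ?orbT//; lra.
have -> : m = e / (1 + e) * m + (1 + e)^-1 * m by field; lra.
by move: le1 le2; rewrite /u; lra.
Qed.

(** Comparing two models requires applying the equivalences to an arbitrary member of one of them,
    which must first be known to be a density. *)
Lemma max_exp_model_densities p q : densities mu p ->
  max_exp_model mu p q -> densities mu q.
Proof.
move=> dp [lq [u [[pu0 /cumulant_lty hu] _] qE]]; have [mp p1 p0] := dp.
have lu := pu0.1.1; split=> //; last first.
  by apply: filterS2 p0 qE => x px ->; rewrite mulr_gt0 ?expR_gt0.
have meu := measurable_expRM mp lu.
have eu0 : {ae mu, forall x, 0 <= expR (u x) * p x}.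
  by apply: filterS p0 => x px; rewrite mulr_ge0 ?expR_ge0 ?ltW.
have nE := ae_integral_norm meu eu0.
have [M hM] : exists M : R, Exp mu p (fun x => expR (u x)) = M%:E.
  exists (fine (Exp mu p (fun x => expR (u x)))); rewrite fineK// ge0_fin_numE//.
  by rewrite /Exp nE integral_ge0.
have M0 : 0 <= M by rewrite -lee_fin -hM /Exp nE integral_ge0.
(* If [M] were 0, then [e^u p], hence [p], would vanish almost everywhere, against its integral 1.
   Positivity is what makes [exp (ln M) = M]. *)
have {}M0 : 0 < M.
  rewrite lt_neqAle M0 andbT; apply/eqP => M0'.
  have /ae_eq_integral_abs : (\int[mu]_x `|(expR (u x) * p x)%:E| = 0)%E.
    by under eq_integral do rewrite abse_EFin; rewrite -nE -[LHS]/(Exp _ _ _) hM -M0'.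
  move=> /(_ measurableT)/(_ ((measurable_EFinP _ _).2 meu)) eu_0.
  have : (\int[mu]_x (p x)%:E = \int[mu]_x (cst 0 x)%:E)%E.
    apply: ae_integralE => //.
    by apply: filterS eu_0 => x /(_ I)[] /eqP; rewrite mulf_eq0 gt_eqF ?expR_gt0//= => /eqP.
  by rewrite p1 integral0 => /eqP; rewrite onee_eq0.
have KE : cumulant mu p u = (ln M)%:E by rewrite /cumulant hM lne_EFin.
rewrite (@ae_integralE _ _ _ _ q (fun x => M^-1 * (expR (u x) * p x)))//.
- under eq_integral do rewrite EFinM.
  rewrite integralZl//; last first.
    apply/integrableP; split; first exact/measurable_EFinP.
    by under eq_integral do rewrite abse_EFin; rewrite -nE.
  by rewrite -[X in (_ * X)%E]/(Exp mu p (fun x => expR (u x))) hM -EFinM mulVf ?gt_eqF.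
- exact: measurable_funM.
by apply: filterS qE => x ->; rewrite KE /= expRD expRN lnK ?posrE// mulrA (mulrC (expR _)).
Qed.

Lemma LPhi1_eq_max_exp_model p q : densities mu p -> densities mu q ->
  LPhi1 mu p = LPhi1 mu q <-> max_exp_model mu p q.
Proof.
move=> dp dq; split=> [pq|/(moment_arc_of_max_exp_model dp dq) arc].
  have pw := LPhi1_eq_log_ratio dp dq pq.
  apply: max_exp_model_of_moment_arc => //.
  by apply: moment_arc_LPhi1_log_ratio => //; rewrite -pq.
exact: moment_arc_LPhi1_eq.
Qed.

End MaximalExponentialModel.

Theorem theorem4p7 (d : measure_display) (T : measurableType d) (R : realType)
    (mu : probability T R) (p q : T -> R)
    (hp : densities mu p) (hq : densities mu q) :
  [<-> max_exp_model mu p q;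
       open_exp_arc mu p q;
       max_exp_model mu p = max_exp_model mu q;
       LPhi1 mu p = LPhi1 mu q;
       (LPhi1 mu p `&` LPhi1 mu q) (fun x => ln (q x / p x));
       exists2 eps : R, 0 < eps &
         Lebesgue mu (1 + eps) p (fun x => q x / p x) /\
         Lebesgue mu (1 + eps) q (fun x => p x / q x)].
Proof.
tfae.
- by move/moment_arc_of_max_exp_model => arc; apply/moment_arc_open => //; exact: arc.
- move/(moment_arc_open hp hq)/(moment_arc_LPhi1_eq hp hq) => pq.
  (* A member [s] of the model at [a] has the Orlicz space of [a], hence that of [b], and so belongs
     to the model at [b]. *)
  have sub a b : densities mu a -> densities mu b -> LPhi1 mu a = LPhi1 mu b ->
      max_exp_model mu a `<=` max_exp_model mu b.
    move=> da db ab s hs; have ds := max_exp_model_densities da hs.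
    by apply/(LPhi1_eq_max_exp_model db ds); rewrite -ab; apply/LPhi1_eq_max_exp_model.
  by apply/seteqP; split; exact: sub.
(* [q] belongs to its own model by reflexivity of equality of Orlicz spaces, hence to that of
   [p]. *)
- by move=> pq; apply/LPhi1_eq_max_exp_model => //; rewrite pq; apply/LPhi1_eq_max_exp_model.
- by move=> pq; have := LPhi1_eq_log_ratio hp hq pq; split; rewrite -?pq.
- move=> [pw qw]; apply/(moment_arc_Lebesgue hp hq).
  exact: moment_arc_LPhi1_log_ratio.
- move=> /(moment_arc_Lebesgue hp hq)/(moment_arc_LPhi1_eq hp hq) pq.
  exact/LPhi1_eq_max_exp_model.
Qed.
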